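(* The functor $E^{\mathbf{Pred}^{\neq}(\mathbf{Set})}\colon\mathbf{Pred}^{\neq}(\mathbf{Set})\to\mathbf{Chu}(\mathbf{Set},\mathrm{Id}^2)$ defined by $$E_0^{\mathbf{Pred}^{\neq}(\mathbf{Set})}(X,\boldsymbol A)=\big(X;A^1,\ i_{A^1}^X\times i_{A^0}^X,\ A^0\big),\qquad i_{A^1}^X\times i_{A^0}^X\colon A^1\times A^0\to\mathrm{Id}^2_0(X)=X\times X,$$ and, for a morphism $(u^0,u^+,u^-)\colon(X,\boldsymbol A)\to(Y,\boldsymbol B)$, $$E_1^{\mathbf{Pred}^{\neq}(\mathbf{Set})}(u^0,u^+,u^-)=(u^0,u^+,u^-)\colon\big(X;A^1,i_{A^1}^X\times i_{A^0}^X,A^0\big)\to\big(Y;B^1,i_{B^1}^Y\times i_{B^0}^Y,B^0\big),$$ is a strict generalised Chu representation of $\mathbf{Pred}^{\neq}(\mathbf{Set})$ into $\mathbf{Chu}(\mathbf{Set},\mathrm{Id}^2)$.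
   Context: $\mathbf{Set}$ is the category of sets and functions in Bishop's sense (a set $X$ comes with an equality $=_X$, and functions respect equality). The endofunctor $\mathrm{Id}^2\colon\mathbf{Set}\to\mathbf{Set}$ is $\mathrm{Id}^2_0(X)=X\times X$, $[\mathrm{Id}^2_1(f)](x,x')=(f(x),f(x'))$. An inequality (apartness relation) on $(X,=_X)$ is a relation $\neq_X$ such that for all $x,y\in X$: $x=_Xy$ and $x\neq_Xy$ imply $\bot$; $x\neq_Xy$ implies $y\neq_Xx$; $x\neq_Xy$ implies that for all $z\in X$, $z\neq_Xx$ or $z\neq_Xy$. A subset of $X$ is a pair $(A,i_A^X)$ with $A$ a set and $i_A^X\colon A\to X$ an injection. A complemented subset of $(X,=_X,\neq_X)$ is a pair $\boldsymbol A=(A^1,A^0)$ of subsets $(A^1,i_{A^1}^X)$, $(A^0,i_{A^0}^X)$ of $X$ with $i_{A^1}^X(a)\neq_Xi_{A^0}^X(b)$ for all $a\in A^1$, $b\in A^0$. The map $i_{A^1}^X\times i_{A^0}^X$ sends $(a^1,a^0)$ to $(i_{A^1}^X(a^1),i_{A^0}^X(a^0))$. $\mathbf{Pred}^{\neq}(\mathbf{Set})$ (category of complemented predicates): objects are pairs $(X,\boldsymbol A)$, with $X$ a set equipped with a fixed inequality and $\boldsymbol A=(A^1,A^0)$ a complemented subset of $X$. A morphism $(X,\boldsymbol A)\to(Y,\boldsymbol B)$ is a triplet $(u^0,u^+,u^-)$ of functions $u^0\colon X\to Y$, $u^+\colon A^1\to B^1$, $u^-\colon B^0\to A^0$ such that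 $u^0\circ i_{A^1}^X=i_{B^1}^Y\circ u^+$ and $u^0\circ i_{A^0}^X\circ u^-=i_{B^0}^Y$. Composition is $(v^0,v^+,v^-)\circ(u^0,u^+,u^-)=(v^0\circ u^0,v^+\circ u^+,u^-\circ v^-)$, and identities are $(\mathrm{id}_X,\mathrm{id}_{A^1},\mathrm{id}_{A^0})$. Generalised Chu category over $\mathbf{Set}$ and an endofunctor $\Gamma\colon\mathbf{Set}\to\mathbf{Set}$: objects of $\mathbf{Chu}(\mathbf{Set},\Gamma)$ are quadruples $(X;A,f,B)$ with $X,A,B$ sets and $f\colon A\times B\to\Gamma_0(X)$; a morphism $(X;A,f,B)\to(Y;C,g,D)$ is a triplet $(\phi^0,\phi^+,\phi^-)$ with $\phi^0\colon X\to Y$, $\phi^+\colon A\to C$, $\phi^-\colon D\to B$ and $\Gamma_1(\phi^0)\circ f\circ(\mathrm{id}_A\times\phi^-)=g\circ(\phi^+\times\mathrm{id}_D)$; $(\theta^0,\theta^+,\theta^-)\circ(\phi^0,\phi^+,\phi^-)=(\theta^0\circ\phi^0,\theta^+\circ\phi^+,\phi^-\circ\theta^-)$, and identities are $(\mathrm{id}_X,\mathrm{id}_A,\mathrm{id}_B)$. An embedding is a functor that is injective on objects and faithful; a representation is a full embedding; a generalised Chu representation is a representation whose codomain is a generalised Chu category; it is strict if it is injective on arrows.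
   Formalization: False if A^0 is empty: ({true},∅) and ({false},∅) in bool have equal images under E, and fullness fails. So, except for faithfulness, the claim is proved only for complemented subsets with A^1 and A^0 both inhabited; each set carries one fixed inequality. *)

(* Defs.v *)
From Stdlib Require Import RelationClasses Eqdep.

Set Implicit Arguments.
Unset Strict Implicit.
Unset Printing Implicit Defensive.

Record bset : Type := BSet {
  carrier :> Type;
  beq : carrier -> carrier -> Prop;
  beq_equiv : Equivalence beq
}.

Notation "x == y" := (beq x y) (at level 70, no associativity).

Lemma beq_refl (X : bset) (x : X) : x == x.
Proof. apply (beq_equiv X). Qed.
Lemma beq_sym (X : bset) (x y : X) : x == y -> y == x.
Proof. apply (beq_equiv X). Qed.
Lemma beq_trans (X : bset) (x y z : X) : x == y -> y == z -> x == z.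
Proof. apply (beq_equiv X). Qed.

Record bfun (X Y : bset) : Type := BFun {
  bapp :> X -> Y;
  bapp_ext : forall x x' : X, x == x' -> bapp x == bapp x'
}.

Definition feq (X Y : bset) (f g : bfun X Y) : Prop := forall x : X, f x == g x.

Definition bid (X : bset) : bfun X X := BFun (fun (x x' : X) (h : x == x') => h).

Definition bcomp (X Y Z : bset) (g : bfun Y Z) (f : bfun X Y) : bfun X Z :=
  BFun (fun (x x' : X) (h : x == x') => bapp_ext g (bapp_ext f h)).

Definition prod_beq (X Y : bset) (p q : X * Y) : Prop :=
  fst p == fst q /\ snd p == snd q.

Lemma prod_beq_equiv (X Y : bset) : Equivalence (@prod_beq X Y).
Proof.
split.
- intros p; split; apply beq_refl.
- intros p q [h k]; split; apply beq_sym; assumption.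
- intros p q r [h k] [h' k']; split; eapply beq_trans; eassumption.
Qed.

Definition bprod (X Y : bset) : bset := BSet (prod_beq_equiv X Y).

Definition bprod_map (X Y X' Y' : bset) (f : bfun X X') (g : bfun Y Y') :
  bfun (bprod X Y) (bprod X' Y') :=
  @BFun (bprod X Y) (bprod X' Y') (fun p => (f (fst p), g (snd p)))
    (fun p q h => conj (bapp_ext f (proj1 h)) (bapp_ext g (proj2 h))).

(** Equality of two functions as arrows: the domains are the same set, the
    codomains are the same set, and the values are equal in the codomain. *)
Inductive fun_eq (X Y : bset) (f : bfun X Y) :
  forall X' Y' : bset, bfun X' Y' -> Prop :=
| fun_eq_intro (g : bfun X Y) : feq f g -> @fun_eq X Y f X Y g.

Lemma fun_eq_refl (X Y : bset) (f : bfun X Y) : fun_eq f f.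
Proof. constructor; intros x; apply beq_refl. Qed.

Ltac fun_eq_same := apply fun_eq_intro; intros ?; apply beq_refl.

Lemma fun_eq_sym (X Y X' Y' : bset) (f : bfun X Y) (g : bfun X' Y') :
  fun_eq f g -> fun_eq g f.
Proof. intros [h e]; constructor; intros x; apply beq_sym, e. Qed.

Lemma fun_eq_trans (X Y X' Y' X'' Y'' : bset)
  (f : bfun X Y) (g : bfun X' Y') (h : bfun X'' Y'') :
  fun_eq f g -> fun_eq g h -> fun_eq f h.
Proof.
intros e1 e2; destruct e2 as [h e2]; destruct e1 as [g e1].
constructor; intros x; eapply beq_trans; [apply e1 | apply e2].
Qed.

Lemma fun_eq_dom (X Y X' Y' : bset) (f : bfun X Y) (g : bfun X' Y') :
  fun_eq f g -> X = X'.
Proof. intros []; reflexivity. Qed.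

Lemma fun_eq_cod (X Y X' Y' : bset) (f : bfun X Y) (g : bfun X' Y') :
  fun_eq f g -> Y = Y'.
Proof. intros []; reflexivity. Qed.

Lemma fun_eqE (X Y : bset) (f g : bfun X Y) : fun_eq f g <-> feq f g.
Proof.
split; [|intros h; constructor; exact h].
enough (H : forall X' Y' (g' : bfun X' Y'), fun_eq f g' ->
  forall (p : X' = X) (q : Y' = Y),
  feq f (eq_rect Y' (bfun X) (eq_rect X' (fun S => bfun S Y') g' X p) Y q)).
{ intros h; exact (H X Y g h eq_refl eq_refl). }
intros X' Y' g' [h e] p q.
rewrite (UIP_refl _ _ p), (UIP_refl _ _ q); exact e.
Qed.

Lemma bid_eq (X X' : bset) : X = X' -> fun_eq (bid X) (bid X').
Proof. intros []; apply fun_eq_refl. Qed.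

Lemma bcomp_eq (X Y Z X' Y' Z' : bset) (f : bfun X Y) (f' : bfun X' Y')
  (g : bfun Y Z) (g' : bfun Y' Z') :
  fun_eq f f' -> fun_eq g g' -> fun_eq (bcomp g f) (bcomp g' f').
Proof.
intros h k.
pose proof (fun_eq_dom h) as <-; pose proof (fun_eq_cod h) as <-.
pose proof (fun_eq_cod k) as <-.
apply fun_eqE in h; apply fun_eqE in k.
constructor; intros x; simpl.
eapply beq_trans; [apply (bapp_ext g), h | apply k].
Qed.

(** [hom_eq] compares arrows of the whole category; on a fixed [hom a b] it is
    the equality of that hom-set.  [hom_eq_transport] says that equal pairs of
    objects have the same arrows. *)
Record category : Type := Category {
  ob :> Type;
  ob_eq : ob -> ob -> Prop;
  hom : ob -> ob -> Type;
  hom_eq : forall {a b a' b' : ob}, hom a b -> hom a' b' -> Prop;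
  idm : forall a, hom a a;
  compm : forall {a b c}, hom b c -> hom a b -> hom a c;
  ob_eq_equiv : Equivalence ob_eq;
  hom_eq_refl : forall a b (f : hom a b), hom_eq f f;
  hom_eq_sym : forall a b a' b' (f : hom a b) (g : hom a' b'),
    hom_eq f g -> hom_eq g f;
  hom_eq_trans : forall a b a' b' a'' b''
    (f : hom a b) (g : hom a' b') (h : hom a'' b''),
    hom_eq f g -> hom_eq g h -> hom_eq f h;
  hom_eq_dom : forall a b a' b' (f : hom a b) (g : hom a' b'),
    hom_eq f g -> ob_eq a a';
  hom_eq_cod : forall a b a' b' (f : hom a b) (g : hom a' b'),
    hom_eq f g -> ob_eq b b';
  hom_eq_transport : forall a b a' b' (f : hom a b),
    ob_eq a a' -> ob_eq b b' -> exists f' : hom a' b', hom_eq f f';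
  idm_eq : forall a a', ob_eq a a' -> hom_eq (idm a) (idm a');
  compm_eq : forall a b c a' b' c' (f : hom a b) (f' : hom a' b')
    (g : hom b c) (g' : hom b' c'),
    hom_eq f f' -> hom_eq g g' -> hom_eq (compm g f) (compm g' f');
  compm_idl : forall a b (f : hom a b), hom_eq (compm (idm b) f) f;
  compm_idr : forall a b (f : hom a b), hom_eq (compm f (idm a)) f;
  compmA : forall a b c d (f : hom a b) (g : hom b c) (h : hom c d),
    hom_eq (compm h (compm g f)) (compm (compm h g) f)
}.

Arguments ob_eq {_} _ _.
Arguments hom {_} _ _.
Arguments hom_eq {_ _ _ _ _} _ _.
Arguments idm {_} _.
Arguments compm {_ _ _ _} _ _.

Record functor (C D : category) : Type := Functor {
  F0 :> C -> D;
  F1 : forall {a b : C}, hom a b -> hom (F0 a) (F0 b);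
  F0_eq : forall a a' : C, ob_eq a a' -> ob_eq (F0 a) (F0 a');
  F1_eq : forall (a b a' b' : C) (f : hom a b) (g : hom a' b'),
    hom_eq f g -> hom_eq (F1 f) (F1 g);
  F1_id : forall a : C, hom_eq (F1 (idm a)) (idm (F0 a));
  F1_comp : forall (a b c : C) (f : hom a b) (g : hom b c),
    hom_eq (F1 (compm g f)) (compm (F1 g) (F1 f))
}.

Arguments F1 {_ _} _ {_ _} _.

Section FunctorProperties.
Variables (C D : category) (F : functor C D).

Definition injective_on_objects : Prop :=
  forall a b : C, ob_eq (F a) (F b) -> ob_eq a b.

Definition faithful : Prop :=
  forall (a b : C) (f g : hom a b), hom_eq (F1 F f) (F1 F g) -> hom_eq f g.

Definition full : Prop :=
  forall (a b : C) (g : hom (F a) (F b)), exists f : hom a b, hom_eq (F1 F f) g.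

Definition injective_on_arrows : Prop :=
  forall (a b a' b' : C) (f : hom a b) (g : hom a' b'),
    hom_eq (F1 F f) (F1 F g) -> hom_eq f g.

Definition embedding : Prop := injective_on_objects /\ faithful.

Definition representation : Prop := embedding /\ full.

End FunctorProperties.

Definition full_subcategory (C : category) (P : C -> Prop) : category.
Proof.
refine (@Category {a : C | P a}
  (fun a b => ob_eq (proj1_sig a) (proj1_sig b))
  (fun a b => hom (proj1_sig a) (proj1_sig b))
  (fun a b a' b' f g => hom_eq f g)
  (fun a => idm (proj1_sig a))
  (fun a b c g f => compm g f) _ _ _ _ _ _ _ _ _ _ _ _).
- split.
  + intros a; apply (ob_eq_equiv C).
  + intros a b; apply (ob_eq_equiv C).
  + intros a b c; apply (ob_eq_equiv C).
- intros; apply hom_eq_refl.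
- intros; apply hom_eq_sym; assumption.
- intros; eapply hom_eq_trans; eassumption.
- intros; eapply hom_eq_dom; eassumption.
- intros; eapply hom_eq_cod; eassumption.
- intros; apply hom_eq_transport; assumption.
- intros; apply idm_eq; assumption.
- intros; apply compm_eq; assumption.
- intros; apply compm_idl.
- intros; apply compm_idr.
- intros; apply compmA.
Defined.

Definition restrict (C D : category) (F : functor C D) (P : C -> Prop) :
  functor (full_subcategory P) D :=
  @Functor (full_subcategory P) D
    (fun a => F (proj1_sig a))
    (fun a b f => F1 F f)
    (fun a a' h => F0_eq F h)
    (fun a b a' b' f g h => F1_eq F h)
    (fun a => F1_id F (proj1_sig a))
    (fun a b c f g => F1_comp F f g).

(** Equality of the objects of [SET] is identity of sets (and not the existence
    of a bijection). *)
Definition SET : category.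
Proof.
refine (@Category bset (@eq bset) bfun
  (fun X Y X' Y' f g => fun_eq f g) bid bcomp _ _ _ _ _ _ _ _ _ _ _ _).
- intros; fun_eq_same.
- intros; apply fun_eq_sym; assumption.
- intros; eapply fun_eq_trans; eassumption.
- intros; eapply fun_eq_dom; eassumption.
- intros; eapply fun_eq_cod; eassumption.
- intros X Y X' Y' f [] []; exists f; fun_eq_same.
- intros X X' []; fun_eq_same.
- intros; apply bcomp_eq; assumption.
- intros; fun_eq_same.
- intros; fun_eq_same.
- intros; fun_eq_same.
Defined.

Definition Id2 : functor SET SET.
Proof.
refine (@Functor SET SET (fun X => bprod X X)
  (fun X Y f => bprod_map f f) _ _ _ _).
- intros X X' []; reflexivity.
- intros X Y X' Y' f g [h e]; constructor; intros p; split; apply e.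
- intros X; constructor; intros p; split; apply beq_refl.
- intros; fun_eq_same.
Defined.

Section Chu.
Variable Gamma : functor SET SET.

(** Written [(chu_base; chu_pos, chu_map, chu_neg)] in the usual notation. *)
Record chu_ob : Type := ChuOb {
  chu_base : bset;
  chu_pos : bset;
  chu_neg : bset;
  chu_map : bfun (bprod chu_pos chu_neg) (Gamma chu_base)
}.

Definition chu_ob_eq (c d : chu_ob) : Prop :=
  chu_base c = chu_base d /\ chu_pos c = chu_pos d /\
  chu_neg c = chu_neg d /\ fun_eq (chu_map c) (chu_map d).

Record chu_hom (c d : chu_ob) : Type := ChuHom {
  chu0 : bfun (chu_base c) (chu_base d);
  chu_plus : bfun (chu_pos c) (chu_pos d);
  chu_minus : bfun (chu_neg d) (chu_neg c);
  chu_square :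
    feq (bcomp (bcomp (F1 Gamma (chu0 : @hom SET (chu_base c) (chu_base d)))
                      (chu_map c))
               (bprod_map (bid (chu_pos c)) chu_minus))
        (bcomp (chu_map d) (bprod_map chu_plus (bid (chu_neg d))))
}.

Definition chu_hom_eq (c d c' d' : chu_ob) (f : chu_hom c d)
  (g : chu_hom c' d') : Prop :=
  chu_ob_eq c c' /\ chu_ob_eq d d' /\ fun_eq (chu0 f) (chu0 g) /\
  fun_eq (chu_plus f) (chu_plus g) /\ fun_eq (chu_minus f) (chu_minus g).

Lemma chu_ob_eq_equiv : Equivalence chu_ob_eq.
Proof.
split.
- intros c; repeat apply conj; try reflexivity; fun_eq_same.
- intros c d (h1 & h2 & h3 & h4); repeat apply conj; try (symmetry; assumption).
  apply fun_eq_sym; assumption.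
- intros c d e (h1 & h2 & h3 & h4) (k1 & k2 & k3 & k4); repeat apply conj;
    try (etransitivity; eassumption).
  eapply fun_eq_trans; eassumption.
Qed.

Lemma Gamma1_feq (X Y : bset) (f g : bfun X Y) :
  feq f g -> feq (F1 Gamma (f : @hom SET X Y)) (F1 Gamma (g : @hom SET X Y)).
Proof.
intros h; apply fun_eqE.
apply (F1_eq Gamma (f := f : @hom SET X Y) (g := g : @hom SET X Y)).
apply fun_eqE; exact h.
Qed.

Definition chu_id (c : chu_ob) : chu_hom c c.
Proof.
refine (@ChuHom c c (bid _) (bid _) (bid _) _).
intros p; simpl.
pose proof (F1_id Gamma (chu_base c)) as h; apply fun_eqE in h.
refine (beq_trans (h _) _); apply beq_refl.
Defined.

Definition chu_comp (c d e : chu_ob) (g : chu_hom d e) (f : chu_hom c d) :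
  chu_hom c e.
Proof.
refine (@ChuHom c e (bcomp (chu0 g) (chu0 f))
  (bcomp (chu_plus g) (chu_plus f)) (bcomp (chu_minus f) (chu_minus g)) _).
intros p; simpl.
pose proof (F1_comp Gamma (chu0 f : @hom SET _ _) (chu0 g : @hom SET _ _)) as h.
apply fun_eqE in h.
refine (beq_trans (h _) _).
refine (beq_trans (bapp_ext _ (chu_square f (fst p, chu_minus g (snd p)))) _).
exact (chu_square g (chu_plus f (fst p), snd p)).
Defined.

Definition Chu : category.
Proof.
refine (@Category chu_ob chu_ob_eq chu_hom chu_hom_eq chu_id chu_comp
  _ _ _ _ _ _ _ _ _ _ _ _).
- exact chu_ob_eq_equiv.
- intros c d f; repeat apply conj; try reflexivity; fun_eq_same.
- intros c d c' d' f g (h1 & h2 & h3 & h4 & h5).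
  split; [apply chu_ob_eq_equiv; exact h1|].
  split; [apply chu_ob_eq_equiv; exact h2|].
  repeat apply conj; apply fun_eq_sym; assumption.
- intros c d c' d' c'' d'' f g h (h1 & h2 & h3 & h4 & h5)
    (k1 & k2 & k3 & k4 & k5).
  split; [apply (@Equivalence_Transitive _ _ chu_ob_eq_equiv _ c'); assumption|].
  split; [apply (@Equivalence_Transitive _ _ chu_ob_eq_equiv _ d'); assumption|].
  repeat apply conj; eapply fun_eq_trans; eassumption.
- intros c d c' d' f g h; apply h.
- intros c d c' d' f g h; apply h.
- intros c d c' d' f hc hd.
  pose proof hc as hc'; pose proof hd as hd'.
  destruct c as [X A B m], c' as [X' A' B' m'].
  destruct d as [Y C D n], d' as [Y' C' D' n'].
  destruct hc as (e1 & e2 & e3 & e4), hd as (k1 & k2 & k3 & k4).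
  simpl in e1, e2, e3, e4, k1, k2, k3, k4; subst X' A' B' Y' C' D'.
  apply fun_eqE in e4; apply fun_eqE in k4.
  destruct f as [f0 fp fm fs]; simpl in f0, fp, fm, fs.
  unshelve eexists (@ChuHom (ChuOb m') (ChuOb n') f0 fp fm _).
  + intros p; refine (beq_trans _ (beq_trans (fs p) (k4 _))); simpl.
    apply bapp_ext, beq_sym, e4.
  + split; [exact hc'|]; split; [exact hd'|].
    repeat apply conj; fun_eq_same.
- intros c c' h; split; [exact h|]; split; [exact h|].
  destruct h as (e1 & e2 & e3 & e4); simpl.
  repeat apply conj; apply bid_eq; assumption.
- intros c d e c' d' e' f f' g g' (h1 & h2 & h3 & h4 & h5)
    (k1 & k2 & k3 & k4 & k5).
  split; [exact h1|]; split; [exact k2|].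
  repeat apply conj; apply bcomp_eq; assumption.
- intros c d f; repeat apply conj; try reflexivity; fun_eq_same.
- intros c d f; repeat apply conj; try reflexivity; fun_eq_same.
- intros a b c d f g h; repeat apply conj; try reflexivity; fun_eq_same.
Defined.

Definition strict_generalised_chu_representation (C : category)
  (F : functor C Chu) : Prop :=
  representation F /\ injective_on_arrows F.

End Chu.

Record inequality (X : bset) : Type := Inequality {
  neq :> X -> X -> Prop;
  neq_irrefl : forall x y : X, x == y -> neq x y -> False;
  neq_sym : forall x y : X, neq x y -> neq y x;
  neq_cotrans : forall x y : X, neq x y -> forall z : X, neq z x \/ neq z y
}.

Record subset (X : bset) : Type := Subset {
  sub_dom :> bset;
  sub_inj : bfun sub_dom X;
  sub_injective : forall a b : sub_dom, sub_inj a == sub_inj b -> a == b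
}.

Record complemented_subset (X : bset) (ne : inequality X) : Type := Compl {
  cs1 : subset X;
  cs0 : subset X;
  cs_apart : forall (a : cs1) (b : cs0), ne (sub_inj cs1 a) (sub_inj cs0 b)
}.

Section Pred.

(** One inequality is fixed for each set, so [E], which forgets it, loses no
    information there.  A set always has one: the empty relation. *)
Variable ne : forall X : bset, inequality X.

Record pred_ob : Type := PredOb {
  pred_base : bset;
  pred_cs : complemented_subset (ne pred_base)
}.

Notation dom1 a := (cs1 (pred_cs a)).
Notation dom0 a := (cs0 (pred_cs a)).
Notation inj1 a := (sub_inj (cs1 (pred_cs a))).
Notation inj0 a := (sub_inj (cs0 (pred_cs a))).

(** Identity of the base set and of the two subsets as pairs (domain, injection);
    the domains agree by [fun_eq]. *)
Definition pred_ob_eq (a b : pred_ob) : Prop :=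
  pred_base a = pred_base b /\
  fun_eq (inj1 a) (inj1 b) /\ fun_eq (inj0 a) (inj0 b).

Record pred_hom (a b : pred_ob) : Type := PredHom {
  pred0 : bfun (pred_base a) (pred_base b);
  pred_plus : bfun (dom1 a) (dom1 b);
  pred_minus : bfun (dom0 b) (dom0 a);
  pred_square1 : feq (bcomp pred0 (inj1 a)) (bcomp (inj1 b) pred_plus);
  pred_square0 : feq (bcomp (bcomp pred0 (inj0 a)) pred_minus) (inj0 b)
}.

Definition pred_hom_eq (a b a' b' : pred_ob) (f : pred_hom a b)
  (g : pred_hom a' b') : Prop :=
  pred_ob_eq a a' /\ pred_ob_eq b b' /\ fun_eq (pred0 f) (pred0 g) /\
  fun_eq (pred_plus f) (pred_plus g) /\ fun_eq (pred_minus f) (pred_minus g).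

Lemma pred_ob_eq_equiv : Equivalence pred_ob_eq.
Proof.
split.
- intros a; repeat apply conj; try reflexivity; fun_eq_same.
- intros a b (h1 & h2 & h3); repeat apply conj;
    first [symmetry; assumption | apply fun_eq_sym; assumption].
- intros a b c (h1 & h2 & h3) (k1 & k2 & k3); repeat apply conj;
    first [etransitivity; eassumption | eapply fun_eq_trans; eassumption].
Qed.

Definition pred_id (a : pred_ob) : pred_hom a a.
Proof.
refine (@PredHom a a (bid _) (bid _) (bid _) _ _);
  intros x; apply beq_refl.
Defined.

Definition pred_comp (a b c : pred_ob) (g : pred_hom b c) (f : pred_hom a b) :
  pred_hom a c.
Proof.
refine (@PredHom a c (bcomp (pred0 g) (pred0 f))
  (bcomp (pred_plus g) (pred_plus f)) (bcomp (pred_minus f) (pred_minus g)) _ _).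
- intros x; simpl.
  refine (beq_trans (bapp_ext _ (pred_square1 f x)) _).
  exact (pred_square1 g _).
- intros x; simpl.
  refine (beq_trans (bapp_ext _ (pred_square0 f _)) _).
  exact (pred_square0 g x).
Defined.

Definition Pred : category.
Proof.
refine (@Category pred_ob pred_ob_eq pred_hom pred_hom_eq pred_id pred_comp
  _ _ _ _ _ _ _ _ _ _ _ _).
- exact pred_ob_eq_equiv.
- intros a b f; repeat apply conj; try reflexivity; fun_eq_same.
- intros a b a' b' f g (h1 & h2 & h3 & h4 & h5).
  split; [apply pred_ob_eq_equiv; exact h1|].
  split; [apply pred_ob_eq_equiv; exact h2|].
  repeat apply conj; apply fun_eq_sym; assumption.
- intros a b a' b' a'' b'' f g h (h1 & h2 & h3 & h4 & h5)
    (k1 & k2 & k3 & k4 & k5).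
  split; [apply (@Equivalence_Transitive _ _ pred_ob_eq_equiv _ a'); assumption|].
  split; [apply (@Equivalence_Transitive _ _ pred_ob_eq_equiv _ b'); assumption|].
  repeat apply conj; eapply fun_eq_trans; eassumption.
- intros a b a' b' f g h; apply h.
- intros a b a' b' f g h; apply h.
- intros a b a' b' f ha hb.
  pose proof ha as ha'; pose proof hb as hb'.
  destruct a as [X [[A1 i1 u1] [A0 i0 u0] uA]].
  destruct a' as [X' [[A1' i1' u1'] [A0' i0' u0'] uA']].
  destruct b as [Y [[B1 j1 v1] [B0 j0 v0] vB]].
  destruct b' as [Y' [[B1' j1' v1'] [B0' j0' v0'] vB']].
  destruct ha as (e & e1 & e0), hb as (k & k1 & k0); simpl in *.
  pose proof (fun_eq_dom e1) as p1; pose proof (fun_eq_dom e0) as p0.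
  pose proof (fun_eq_dom k1) as q1; pose proof (fun_eq_dom k0) as q0.
  subst X' Y' A1' A0' B1' B0'.
  apply fun_eqE in e1; apply fun_eqE in e0.
  apply fun_eqE in k1; apply fun_eqE in k0.
  destruct f as [f fp fm s1 s0]; simpl in f, fp, fm, s1, s0.
  unshelve eexists (@PredHom
    (@PredOb X (@Compl X (ne X) (Subset u1') (Subset u0') uA'))
    (@PredOb Y (@Compl Y (ne Y) (Subset v1') (Subset v0') vB')) f fp fm _ _).
  + intros x; refine (beq_trans _ (beq_trans (s1 x) (k1 _))); simpl.
    apply bapp_ext, beq_sym, e1.
  + intros x; refine (beq_trans _ (beq_trans (s0 x) (k0 _))); simpl.
    apply bapp_ext, beq_sym, e0.
  + split; [exact ha'|]; split; [exact hb'|].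
    repeat apply conj; fun_eq_same.
- intros a a' h; split; [exact h|]; split; [exact h|].
  destruct h as (e & e1 & e0); simpl.
  pose proof (fun_eq_dom e1); pose proof (fun_eq_dom e0).
  repeat apply conj; apply bid_eq; assumption.
- intros a b c a' b' c' f f' g g' (h1 & h2 & h3 & h4 & h5)
    (k1 & k2 & k3 & k4 & k5).
  split; [exact h1|]; split; [exact k2|].
  repeat apply conj; apply bcomp_eq; assumption.
- intros a b f; repeat apply conj; try reflexivity; fun_eq_same.
- intros a b f; repeat apply conj; try reflexivity; fun_eq_same.
- intros a b c d f g h; repeat apply conj; try reflexivity; fun_eq_same.
Defined.

Definition E0 (a : pred_ob) : chu_ob Id2 :=
  @ChuOb Id2 (pred_base a) (dom1 a) (dom0 a) (bprod_map (inj1 a) (inj0 a)).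

Definition E1 (a b : pred_ob) (u : pred_hom a b) : chu_hom (E0 a) (E0 b) :=
  @ChuHom Id2 (E0 a) (E0 b) (pred0 u) (pred_plus u) (pred_minus u)
    (fun p => conj (pred_square1 u (fst p)) (pred_square0 u (snd p))).

Lemma E0_eq (a b : pred_ob) : pred_ob_eq a b -> chu_ob_eq (E0 a) (E0 b).
Proof.
destruct a as [X [[A1 i1 u1] [A0 i0 u0] uA]].
destruct b as [Y [[B1 j1 v1] [B0 j0 v0] vB]].
intros (e & e1 & e0); simpl in e, e1, e0.
pose proof (fun_eq_dom e1) as p1; pose proof (fun_eq_dom e0) as p0.
subst Y B1 B0; apply fun_eqE in e1; apply fun_eqE in e0.
repeat apply conj; simpl; try reflexivity.
apply fun_eqE; intros p; split; [apply e1 | apply e0].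
Qed.

Definition E : functor Pred (Chu Id2).
Proof.
refine (@Functor Pred (Chu Id2) E0 E1 E0_eq _ _ _).
- intros a b a' b' f g (h1 & h2 & h3 & h4 & h5).
  split; [apply E0_eq; exact h1|]; split; [apply E0_eq; exact h2|].
  repeat apply conj; assumption.
- intros a; repeat apply conj; try reflexivity; fun_eq_same.
- intros a b c f g; repeat apply conj; try reflexivity; fun_eq_same.
Defined.

Definition inhabited_components (a : Pred) : Prop :=
  inhabited (dom1 a) /\ inhabited (dom0 a).

End Pred.

Arguments E0_eq {ne a b} _.

(** If [A^0] is empty, so is [A^1 * A^0], and [i_{A^1} * i_{A^0}] carries no
    information on [i_{A^1}].  For the complemented subsets [({true}, empty)]
    and [({false}, empty)] of [bool], whatever the inequality, the images under
    [E] are equal, and the identities form a Chu morphism between them that is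
    not the image of a morphism of complemented predicates.  Hence [E] is full and
    injective on objects only after restriction to [inhabited_components]. *)

Section EmptyComponent.
Variable ne : forall X : bset, inequality X.

Let eq_bset (T : Type) : bset := BSet (@eq_equivalence T).

Let eq_fun (S T : Type) (f : S -> T) : bfun (eq_bset S) (eq_bset T) :=
  @BFun (eq_bset S) (eq_bset T) f (fun x x' h => f_equal f h).

Let point (t : bool) : subset (eq_bset bool) :=
  @Subset (eq_bset bool) (eq_bset unit) (eq_fun (fun _ => t))
    (fun a b _ => match a, b with tt, tt => eq_refl end).

Let void : subset (eq_bset bool) :=
  @Subset (eq_bset bool) (eq_bset Empty_set)
    (eq_fun (fun x : Empty_set => match x with end))
    (fun a _ _ => match a with end).

Definition point_pred (t : bool) : Pred ne :=
  @PredOb ne (eq_bset bool)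
    (@Compl _ _ (point t) void (fun _ b => match b with end)).

Lemma E_not_injective_on_objects : ~ injective_on_objects (E ne).
Proof.
intros h.
assert (k : ob_eq (point_pred true) (point_pred false)).
{ apply h; repeat apply conj; try reflexivity.
  apply fun_eqE; intros [x []]. }
destruct k as (_ & k & _); simpl in k.
apply fun_eqE in k; discriminate (k tt).
Qed.

Lemma E_not_full : ~ full (E ne).
Proof.
intros h.
pose (g := ChuHom (c := E0 (point_pred true)) (d := E0 (point_pred false))
  (chu0 := bid _) (chu_plus := bid _) (chu_minus := bid _)
  (fun p : bprod (eq_bset unit) (eq_bset Empty_set) =>
     match snd p with end)).
destruct (h (point_pred true) (point_pred false) g) as [f hf].
destruct hf as (_ & _ & h0 & _); apply fun_eqE in h0.
pose proof (h0 true) as e; pose proof (pred_square1 f tt) as e'.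
simpl in e, e'; rewrite e in e'; discriminate e'.
Qed.

End EmptyComponent.

(* Main.v *)
Require Import Defs.

(** The functor [E ne] leaves the three components of a morphism unchanged and
    only pairs the two injections into one map [i1 * i0 : A^1 * A^0 -> X * X].
    So everything reduces to recovering [i1] and [i0] from [i1 * i0], which is
    possible as soon as the other factor has a point at which to evaluate:
    [bprod_map_feq_inv] does this.

    Applied to the structure map of an object, it gives injectivity on objects
    ([E0_reflects_eq]).  Equality of arrows is equality of the components together
    with equality of domains and codomains, so injectivity on objects gives
    injectivity on arrows; faithfulness concerns parallel arrows, whose domains
    and codomains agree from the start, and so holds for empty components as well.
    Applied to the Chu square, which for [Id2] equates two product maps, the same
    lemma gives the two squares of a morphism of complemented predicates, hence
    fullness ([pred_hom_of_chu_hom]). *)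

(** Evaluating the product maps at [(x, b)], for a fixed point [b] of the second
    factor, isolates the first map, and symmetrically. *)
Lemma bprod_map_feq_inv (A B X Y : bset) (f f' : bfun A X) (g g' : bfun B Y) :
  inhabited A -> inhabited B ->
  feq (bprod_map f g) (bprod_map f' g') -> feq f f' /\ feq g g'.
Proof.
intros [a] [b] h; split.
- intros x; exact (proj1 (h (x, b))).
- intros y; exact (proj2 (h (a, y))).
Qed.

Section Representation.
Variable ne : forall X : bset, inequality X.

Lemma E0_reflects_eq (a b : Pred ne) :
  inhabited_components a -> chu_ob_eq (E0 a) (E0 b) -> ob_eq a b.
Proof.
destruct a as [X [[A1 i1 u1] [A0 i0 u0] uA]].
destruct b as [Y [[B1 j1 v1] [B0 j0 v0] vB]].
intros [a1 a0] (e & e1 & e0 & em); simpl in *.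
subst Y B1 B0; apply fun_eqE in em.
destruct (bprod_map_feq_inv _ _ _ _ _ _ _ _ a1 a0 em) as [h1 h0].
split; [reflexivity|]; split; apply fun_eqE; assumption.
Qed.

(** The Chu square lives on [A^1 * B^0], so these are the two components that
    must have a point. *)
Lemma pred_hom_of_chu_hom (a b : Pred ne) (g : chu_hom (E0 a) (E0 b)) :
  inhabited (cs1 (pred_cs a)) -> inhabited (cs0 (pred_cs b)) ->
  exists f : hom a b, hom_eq (F1 (E ne) f) (g : @hom (Chu Id2) _ _).
Proof.
intros a1 b0.
destruct (bprod_map_feq_inv _ _ _ _
  (bcomp (chu0 g) (sub_inj (cs1 (pred_cs a))))
  (bcomp (sub_inj (cs1 (pred_cs b))) (chu_plus g))
  (bcomp (bcomp (chu0 g) (sub_inj (cs0 (pred_cs a)))) (chu_minus g))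
  (sub_inj (cs0 (pred_cs b))) a1 b0 (chu_square g)) as [s1 s0].
exists (PredHom s1 s0).
split; [apply (ob_eq_equiv (Chu Id2))|].
split; [apply (ob_eq_equiv (Chu Id2))|].
repeat apply conj; apply fun_eq_refl.
Qed.

(** Only the equality of domains and codomains is missing in an equality of
    images under [E ne]. *)
Lemma E1_reflects_eq (a b a' b' : Pred ne) (f : hom a b) (g : hom a' b') :
  ob_eq a a' -> ob_eq b b' -> hom_eq (F1 (E ne) f) (F1 (E ne) g) ->
  hom_eq f g.
Proof.
intros ha hb (_ & _ & h); exact (conj ha (conj hb h)).
Qed.

Lemma E_faithful : faithful (E ne).
Proof.
intros a b f g; apply E1_reflects_eq; apply (ob_eq_equiv (Pred ne)).
Qed.

End Representation.

Theorem proposition11p2 (ne : forall X : bset, inequality X) :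
  faithful (E ne) /\
  strict_generalised_chu_representation
    (restrict (E ne) (@inhabited_components ne)).
Proof.
split; [apply E_faithful|]; split; [split; [split|]|].
- intros [a ha] [b hb]; exact (E0_reflects_eq _ a b ha).
- intros [a ha] [b hb]; exact (E_faithful ne a b).
- intros [a ha] [b hb] g.
  exact (pred_hom_of_chu_hom ne a b g (proj1 ha) (proj2 hb)).
- intros [a ha] [b hb] [a' ha'] [b' hb'] f g h.
  apply (E1_reflects_eq ne a b a' b').
  + exact (E0_reflects_eq _ a a' ha (hom_eq_dom h)).
  + exact (E0_reflects_eq _ b b' hb (hom_eq_cod h)).
  + exact h.
Qed.
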